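(* Let $K$ be the second-order cone $K_p^m=\{x\in\mathbb{R}^m:x_m\ge\|(x_1,\dots,x_{m-1})\|\}$ in $\mathbb{R}^m$, and let $\overline{A}=[\overline a_1\mid\dots\mid\overline a_m]^T\in\mathbb{R}^{m\times n}$, $\overline b\in\mathbb{R}^m$ be such that $\{x\in\mathbb{R}^n:\overline Ax+\overline b\in -K\}\neq\emptyset$. Then the radius of robust feasibility satisfies $$\frac{1}{\sqrt{m-1}+1}\,f^\ast_{SOC}\le\rho(\overline A,\overline b)\le f^\ast_{SOC},$$ where $f^\ast_{SOC}$ is the optimal value of the second-order cone program $$\inf_{(z,s,t,\lambda)\in\mathbb{R}^n\times\mathbb{R}\times\mathbb{R}\times\mathbb{R}^m}\Big\{t:\ \|(z,s)\|\le t,\ z=\overline A^T\lambda,\ s\ge-\overline b^T\lambda,\ \|(\lambda_1,\dots,\lambda_{m-1})\|\le1,\ \lambda_m=1\Big\}.$$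
   Context: $\|\cdot\|$ is the Euclidean norm, $\mathbb{B}_{n+1}$ the closed Euclidean unit ball of $\mathbb{R}^{n+1}$. For $r\in\mathbb{R}^m_+$, the robust feasible set is $$F_r(\overline A,\overline b)=\{x\in\mathbb{R}^n: (a_1^Tx+b_1,\dots,a_m^Tx+b_m)^T\in -K\ \ \forall (a_i,b_i)\in(\overline a_i,\overline b_i)+r_i\mathbb{B}_{n+1},\ i=1,\dots,m\}.$$ The admissible set is $C(\overline A,\overline b)=\{r\in\mathbb{R}^m_+:F_r(\overline A,\overline b)\ne\emptyset\}$, and the radius of robust feasibility is $\rho(\overline A,\overline b)=\sup\{\alpha\in\mathbb{R}_+:\alpha 1_m\in C(\overline A,\overline b)\}$, with $1_m$ the all-ones vector. *)

(* Defs.v *)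
From mathcomp Require Import all_boot all_order all_algebra.
From mathcomp Require Import all_classical all_reals ereal.

Set Implicit Arguments.
Unset Strict Implicit.
Unset Printing Implicit Defensive.

Import Order.TTheory GRing.Theory Num.Theory.
Local Open Scope classical_set_scope.
Local Open Scope ring_scope.

(* The norm that mathcomp-analysis puts on matrices is the max norm. *)
Definition enorm (R : realType) (k : nat) (v : 'cV[R]_k) : R :=
  Num.sqrt (\sum_(i < k) v i 0 ^+ 2).

Definition unit_ball (R : realType) (k : nat) : set 'cV[R]_k :=
  [set u | enorm u <= 1].

(* The vector (v, s) of R^n x R = R^(n+1). *)
Definition vpair (R : realType) (n : nat) (v : 'cV[R]_n) (s : R) :
  'cV[R]_(n + 1) := col_mx v s%:M.

(* The second-order cone of R^(m+1): coordinates are numbered from 0 to m, so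
   ord_max is the last one and row' ord_max x collects the first m. *)
Definition second_order_cone (R : realType) (m : nat) : set 'cV[R]_m.+1 :=
  [set x | enorm (row' ord_max x) <= x ord_max 0].

Section RobustFeasibility.
Variables (R : realType) (m n : nat) (K : set 'cV[R]_m).
Variables (A0 : 'M[R]_(m, n)) (b0 : 'cV[R]_m).

Definition feasible (A : 'M[R]_(m, n)) (b : 'cV[R]_m) (x : 'cV[R]_n) : Prop :=
  [set - y | y in K] (A *m x + b).

(* (a_i, b_i), where a_i^T is the i-th row of A. *)
Definition data (A : 'M[R]_(m, n)) (b : 'cV[R]_m) (i : 'I_m) :
  'cV[R]_(n + 1) := vpair (row i A)^T (b i 0).

Definition uncertainty_set (r : 'cV[R]_m) (i : 'I_m) : set 'cV[R]_(n + 1) :=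
  [set data A0 b0 i + r i 0 *: u | u in @unit_ball R (n + 1)].

Definition robust_feasible_set (r : 'cV[R]_m) : set 'cV[R]_n :=
  [set x | forall (A : 'M[R]_(m, n)) (b : 'cV[R]_m),
     (forall i, uncertainty_set r i (data A b i)) -> feasible A b x].

Definition admissible_set : set 'cV[R]_m :=
  [set r : 'cV[R]_m | (forall i, 0 <= r i 0) /\ robust_feasible_set r !=set0].

Definition radius_robust_feasibility : \bar R :=
  ereal_sup [set alpha%:E | alpha in
    [set alpha : R | 0 <= alpha /\ admissible_set (const_mx alpha)]].

End RobustFeasibility.

Section SOCP.
Variables (R : realType) (m n : nat).
Variables (A0 : 'M[R]_(m.+1, n)) (b0 : 'cV[R]_m.+1).

Definition socp_feasible (z : 'cV[R]_n) (s t : R) (lambda : 'cV[R]_m.+1) :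
    Prop :=
  [/\ enorm (vpair z s) <= t,
      z = A0^T *m lambda,
      - (b0^T *m lambda) 0 0 <= s,
      enorm (row' ord_max lambda) <= 1
    & lambda ord_max 0 = 1].

Definition socp_value : \bar R :=
  ereal_inf [set t%:E | t in
    [set t : R | exists z s lambda, socp_feasible z s t lambda]].

End SOCP.

(* Main.v *)
(* For x with margin c, i.e. A x + b + c w e_m in -K where w = |(x, 1)|, the
   robust condition at radius a is sandwiched: it implies margin a (perturb the
   last row only, along (x, 1)), and margin a (sqrt (m - 1) + 1) implies it,
   since the perturbation moves each coordinate by at most a w. By self-duality
   of K, margin c means l^T (A x + b) <= - c w for every l in the base
   {|(l_1, .., l_(m-1))| <= 1, l_m = 1}. The best margin is the value f of the
   program: margin c forces c <= f by Cauchy-Schwarz applied to (z, s) and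
   (x, -1); conversely, projecting the origin on the convex set of feasible
   (z, s) separates it from that set by a hyperplane of normal (z, s), and
   x = - z / s has margin arbitrarily close to f. *)
Require Import Defs.
From mathcomp Require Import all_boot all_order all_algebra.
From mathcomp Require Import all_classical all_reals ereal.
From mathcomp Require Import ring lra.

Set Implicit Arguments.
Unset Strict Implicit.
Unset Printing Implicit Defensive.

Import Order.TTheory GRing.Theory Num.Theory.
Local Open Scope classical_set_scope.
Local Open Scope ring_scope.

(** * Euclidean inner product and norm, and an approximate projection *)

Section Dot.
Variable R : realType.

Definition dot (k : nat) (u v : 'cV[R]_k) : R := \sum_(i < k) u i 0 * v i 0.

Lemma dotC k (u v : 'cV[R]_k) : dot u v = dot v u.
Proof. by apply: eq_bigr => i _; rewrite mulrC. Qed.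

Lemma dotDl k (u v w : 'cV[R]_k) : dot (u + v) w = dot u w + dot v w.
Proof. by rewrite -big_split /=; apply: eq_bigr => i _; rewrite mxE mulrDl. Qed.

Lemma dotZl k a (u v : 'cV[R]_k) : dot (a *: u) v = a * dot u v.
Proof. by rewrite mulr_sumr; apply: eq_bigr => i _; rewrite mxE mulrA. Qed.

Lemma dotDr k (u v w : 'cV[R]_k) : dot w (u + v) = dot w u + dot w v.
Proof. by rewrite dotC dotDl !(dotC w). Qed.

Lemma dotZr k a (u v : 'cV[R]_k) : dot v (a *: u) = a * dot v u.
Proof. by rewrite dotC dotZl dotC. Qed.

Lemma dotE k (u v : 'cV[R]_k) : dot u v = (u^T *m v) 0 0.
Proof. by rewrite mxE; apply: eq_bigr => i _; rewrite mxE. Qed.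

Lemma dot_tr_mul k l (B : 'M[R]_(k, l)) (u : 'cV[R]_k) (v : 'cV[R]_l) :
  dot (B^T *m u) v = dot u (B *m v).
Proof. by rewrite !dotE trmx_mul trmxK mulmxA. Qed.

Lemma vpairD0 n (z : 'cV[R]_n) s s' : vpair z s + vpair 0 s' = vpair z (s + s').
Proof. by rewrite /vpair add_col_mx addr0 -raddfD. Qed.

Lemma dot_vpair n (z z' : 'cV[R]_n) s s' :
  dot (vpair z s) (vpair z' s') = dot z z' + s * s'.
Proof.
rewrite /dot big_split_ord /= big_ord1; congr (_ + _).
  by apply: eq_bigr => i _; rewrite !col_mxEu.
by rewrite !col_mxEd !mxE.
Qed.

Lemma dot_row' m (i : 'I_m.+1) (u v : 'cV[R]_m.+1) :
  dot u v = dot (row' i u) (row' i v) + u i 0 * v i 0.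
Proof.
rewrite /dot (bigD1_ord i) //= addrC; congr (_ + _).
by apply: eq_bigr => j _; rewrite !mxE.
Qed.

Lemma dot_ge0 k (u : 'cV[R]_k) : 0 <= dot u u.
Proof. by apply: sumr_ge0 => i _; rewrite -expr2 sqr_ge0. Qed.

Lemma enormE k (u : 'cV[R]_k) : enorm u = Num.sqrt (dot u u).
Proof. by congr (Num.sqrt _); apply: eq_bigr => i _; rewrite expr2. Qed.

Lemma enorm_ge0 k (u : 'cV[R]_k) : 0 <= enorm u.
Proof. exact: sqrtr_ge0. Qed.

Lemma enorm_sqr k (u : 'cV[R]_k) : enorm u ^+ 2 = dot u u.
Proof. by rewrite enormE sqr_sqrtr // dot_ge0. Qed.

Lemma enorm_leP k (u : 'cV[R]_k) (c : R) : 0 <= c ->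
  (enorm u <= c) = (dot u u <= c ^+ 2).
Proof. by move=> c0; rewrite -enorm_sqr ler_sqr ?nnegrE ?enorm_ge0. Qed.

Lemma enorm0_eq0 k (u : 'cV[R]_k) : enorm u = 0 -> u = 0.
Proof.
move=> /(congr1 (fun c => c ^+ 2)); rewrite enorm_sqr expr0n /= => /eqP.
rewrite psumr_eq0 => [/allP u0|i _]; last by rewrite -expr2 sqr_ge0.
apply/colP => i; rewrite mxE.
by have /= := u0 i (mem_index_enum i); rewrite mulf_eq0 orbb => /eqP.
Qed.

Lemma enormZ k a (u : 'cV[R]_k) : enorm (a *: u) = `|a| * enorm u.
Proof.
by rewrite !enormE dotZl dotZr mulrA -expr2 sqrtrM ?sqr_ge0 // sqrtr_sqr.
Qed.

Lemma enormN k (u : 'cV[R]_k) : enorm (- u) = enorm u.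
Proof. by rewrite -scaleN1r enormZ normrN1 mul1r. Qed.

Lemma cauchy_schwarz k (u v : 'cV[R]_k) : dot u v <= enorm u * enorm v.
Proof.
have [u0|u0] := eqVneq (enorm u) 0.
  by rewrite u0 (enorm0_eq0 u0) mul0r -(scale0r v) dotZl mul0r.
have [v0|v0] := eqVneq (enorm v) 0.
  by rewrite v0 (enorm0_eq0 v0) mulr0 -(scale0r u) dotZr mul0r.
have c0 : 0 < enorm u * enorm v by rewrite mulr_gt0 // lt0r ?u0 ?v0 enorm_ge0.
(* The square expands to [2 * (a * b) * (a * b - d)]; dividing by [a * b > 0] gives the claim. *)
have := dot_ge0 (enorm v *: u + (- enorm u) *: v).
rewrite !(dotDl, dotDr, dotZl, dotZr) -!enorm_sqr (dotC v u).
set a := enorm u; set b := enorm v; set d := dot u v => h.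
rewrite -subr_ge0 -(pmulr_rge0 _ c0); rewrite -/a -/b; nra.
Qed.

Lemma enormD k (u v : 'cV[R]_k) : enorm (u + v) <= enorm u + enorm v.
Proof.
rewrite enorm_leP ?addr_ge0 ?enorm_ge0 //.
rewrite !(dotDl, dotDr) -!enorm_sqr (dotC v u).
have := cauchy_schwarz u v; nra.
Qed.

(** Passing from a bound on each coordinate to one on the norm is where the square root in the lower
    bound comes from. *)
Lemma enorm_le_coord k (u : 'cV[R]_k) c :
  (forall i, `|u i 0| <= c) -> 0 <= c -> enorm u <= Num.sqrt k%:R * c.
Proof.
move=> uc c0; rewrite enorm_leP ?mulr_ge0 ?sqrtr_ge0 //.
rewrite exprMn sqr_sqrtr ?ler0n //.
have -> : k%:R * c ^+ 2 = \sum_(i < k) c ^+ 2.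
  by rewrite sumr_const card_ord mulr_natl.
apply: ler_sum => i _; rewrite -expr2 -real_normK ?num_real //.
by rewrite ler_sqr ?nnegrE.
Qed.

(** Keeps the image of the bounded base of the cone within the radius [M] of
    [approximate_projection]. *)
Lemma enorm_mul_bounded k l (B : 'M[R]_(k, l)) :
  exists2 M : R, 0 <= M & forall u : 'cV[R]_l, enorm (B *m u) <= M * enorm u.
Proof.
pose N : R := \sum_(i < k) enorm (row i B)^T.
have rowN i : enorm (row i B)^T <= N.
  by rewrite /N (bigD1 i) //= lerDl sumr_ge0 // => j _; rewrite enorm_ge0.
have N0 : 0 <= N by apply: sumr_ge0 => i _; rewrite enorm_ge0.
exists (Num.sqrt k%:R * N) => [|u]; first by rewrite mulr_ge0 ?sqrtr_ge0.
rewrite -mulrA; apply: enorm_le_coord => [i|]; last by rewrite mulr_ge0 ?enorm_ge0.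
have uE : (B *m u) i 0 = dot (row i B)^T u.
  by rewrite dotE trmxK -row_mul [RHS]mxE.
have bd v : dot (row i B)^T v <= N * enorm v.
  apply: le_trans (cauchy_schwarz _ _) _.
  by rewrite ler_wpM2r ?enorm_ge0.
rewrite uE ler_norml bd andbT lerNl -mulN1r -dotZr scaleN1r.
by rewrite -[in leRHS](enormN u) bd.
Qed.

(* Almost minimal points almost satisfy the variational inequality that
   characterizes the projection of the origin, so no minimizer is needed. *)
Lemma approximate_projection k (S : set 'cV[R]_k) (F M d : R) :
  (forall p q t, S p -> S q -> 0 <= t <= 1 -> S (p + t *: (q - p))) ->
  (forall p, S p -> F <= enorm p) -> 0 <= F -> 0 < d ->
  exists2 e : R, 0 < e & forall p, S p -> enorm p < F + e ->
    forall q, S q -> enorm q <= M -> F ^+ 2 - d <= dot p q.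
Proof.
move=> convS SF F0 d0.
(* [D] bounds [|q - p|^2], as [|p| < F + 1]; the terms [d + 1] keep [D > 0] and the step length
   [t = d / D] at most 1. *)
pose D : R := (M + F + 1) ^+ 2 + d + 1.
have D0 : 0 < D by rewrite /D; have := sqr_ge0 (M + F + 1); lra.
pose t : R := d / D.
have tD : t * D = d by rewrite /t divfK ?gt_eqF.
have t0 : 0 < t by rewrite divr_gt0.
have t1 : t <= 1 by rewrite /t ler_pdivrMr // mul1r /D; have := sqr_ge0 (M + F + 1); lra.
(* Chosen so that [(F + e)^2 <= F^2 + t * d]. *)
pose e : R := Num.min 1 (t * d / (2 * F + 1)).
have F1 : 0 < 2 * F + 1 by lra.
have e0 : 0 < e by rewrite lt_min ltr01 /= divr_gt0 // mulr_gt0.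
have e1 : e <= 1 by rewrite ge_min lexx.
have eF : e * (2 * F + 1) <= t * d.
  by rewrite -ler_pdivlMr // ge_min lexx orbT.
exists e => // p Sp pF q Sq qM.
have := SF _ (convS _ _ t Sp Sq _); rewrite (ltW t0) t1 => /(_ isT) h.
have {h} : F ^+ 2 <= dot (p + t *: (q - p)) (p + t *: (q - p)).
  by rewrite -enorm_sqr ler_sqr ?nnegrE ?enorm_ge0.
have [u uE] : exists u, u = q - p by exists (q - p).
rewrite -uE !(dotDl, dotDr, dotZl, dotZr) (dotC u p) => h.
have uD : dot u u <= D.
  rewrite -enorm_sqr; have := enormD q (- p); rewrite enormN -uE.
  have := enorm_ge0 u; have := enorm_ge0 p; rewrite /D; nra.
have pu : dot p u = dot p q - enorm p ^+ 2.
  by rewrite uE dotDr -scaleN1r dotZr enorm_sqr mulN1r.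
have p2 : enorm p ^+ 2 <= F ^+ 2 + t * d.
  have := enorm_ge0 p; nra.
(* The quadratic term [t^2 * |u|^2] is at most [t^2 * D = t * d], so dividing by [t] leaves
   [- d <= dot p u]. *)
have {}h : F ^+ 2 <= enorm p ^+ 2 + 2 * t * dot p u + t * d.
  rewrite enorm_sqr -tD; have := ltW t0; nra.
have : - d <= dot p u by rewrite -(ler_pM2l t0); lra.
have := SF p Sp; rewrite pu; nra.
Qed.

End Dot.

(** * Margins in the second-order cone and robust feasibility *)

Section SecondOrderCone.
Variable R : realType.

Definition soc_base (m : nat) : set 'cV[R]_m.+1 :=
  [set l | enorm (row' ord_max l) <= 1 /\ l ord_max 0 = 1].

(* The second-order cone is self-dual and [soc_base] is a base of it; [c] is
   the margin with which [- y] lies in the cone. *)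
Lemma soc_marginP m (y : 'cV[R]_m.+1) (c : R) :
  enorm (row' ord_max y) <= - y ord_max 0 - c <->
  forall l, soc_base l -> dot l y <= - c.
Proof.
split=> [yc l [l1 lE]|h].
  rewrite (dot_row' ord_max) lE mul1r.
  have := cauchy_schwarz (row' ord_max l) (row' ord_max y).
  have := enorm_ge0 (row' ord_max y); nra.
(* The maximizer of [dot l y] over the base: the normalized first coordinates of [y], then 1. If
   these coordinates vanish, the inverse of 0 is 0 and [l] still lies in the base. *)
pose l := \col_i (if unlift ord_max i is Some j
  then (enorm (row' ord_max y))^-1 * y (lift ord_max j) 0 else 1) : 'cV[R]_m.+1.
have l_row' : row' ord_max l = (enorm (row' ord_max y))^-1 *: row' ord_max y.
  by apply/colP => i; rewrite !mxE liftK.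
have l_max : l ord_max 0 = 1 by rewrite mxE unlift_none.
have := h l; rewrite (dot_row' ord_max) l_row' l_max dotZl mul1r -enorm_sqr.
rewrite /soc_base /= l_row' l_max enormZ normfV ger0_norm ?enorm_ge0 //.
have [->|y0] := eqVneq (enorm (row' ord_max y)) 0.
  by rewrite invr0 !mul0r ler01 => /(_ (conj isT erefl)); lra.
by rewrite mulVf // expr2 mulKf // => /(_ (conj (lexx _) erefl)); lra.
Qed.

Lemma feasible_socP m n (A : 'M[R]_(m.+1, n)) b x :
  feasible (@second_order_cone R m) A b x <->
  enorm (row' ord_max (A *m x + b)) <= - (A *m x + b) ord_max 0.
Proof.
rewrite /feasible /second_order_cone; split=> [[y yK <-]|h].
  by rewrite linearN /= enormN mxE opprK.
exists (- (A *m x + b)); last by rewrite opprK.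
by rewrite /= linearN /= enormN mxE.
Qed.

Lemma data_dotE m n (A : 'M[R]_(m, n)) b x i :
  (A *m x + b) i 0 = dot (data A b i) (vpair x 1).
Proof.
rewrite /data dot_vpair mulr1 dotE trmxK -row_mul.
by rewrite mxE [in RHS]mxE.
Qed.

Lemma enorm_vpair1_gt0 n (x : 'cV[R]_n) : 0 < enorm (vpair x 1).
Proof.
rewrite enormE sqrtr_gt0 dot_vpair mulr1.
by have := dot_ge0 x; lra.
Qed.

(* Only the last row is perturbed, in the direction of (x, 1). *)
Lemma robust_feasible_margin m n (A : 'M[R]_(m.+1, n)) b x (a : R) :
  0 <= a ->
  robust_feasible_set (@second_order_cone R m) A b (const_mx a) x ->
  enorm (row' ord_max (A *m x + b)) <=
    - (A *m x + b) ord_max 0 - a * enorm (vpair x 1).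
Proof.
move=> a0 xrob; set w := enorm (vpair x 1).
have w0 : 0 < w := enorm_vpair1_gt0 x.
(* The shift [(a / w) (x, 1)] has norm [a] and moves the last coordinate by [a * w]. *)
pose e (i : 'I_m.+1) : R := (i == ord_max)%:R * (a / w).
pose A' := \matrix_(i, j) (A i j + e i * x j 0) : 'M[R]_(m.+1, n).
pose b' := \col_i (b i 0 + e i) : 'cV[R]_m.+1.
have dataE i : data A' b' i = data A b i + e i *: vpair x 1.
  rewrite /data /vpair scale_col_mx add_col_mx; congr col_mx.
    by apply/colP => j; rewrite !mxE.
  by apply/colP => j; rewrite !mxE (ord1 j) mulr1.
have /xrob/feasible_socP : forall i,
    uncertainty_set A b (const_mx a) i (data A' b' i).
  move=> i; rewrite dataE /uncertainty_set /=.
  exists (((i == ord_max)%:R / w) *: vpair x 1); last first.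
    by rewrite mxE scalerA /e; congr (_ + _ *: _); ring.
  rewrite /unit_ball /= enormZ normrM normfV (gtr0_norm w0) (divfK (lt0r_neq0 w0)).
  by rewrite normr_nat; case: (i == _); rewrite ?ler01.
have y'E i : (A' *m x + b') i 0 = (A *m x + b) i 0 + e i * w ^+ 2.
  by rewrite !data_dotE dataE dotDl dotZl enorm_sqr.
have -> : row' ord_max (A' *m x + b') = row' ord_max (A *m x + b).
  apply/colP => i; rewrite [LHS]mxE y'E [RHS]mxE /e.
  by rewrite eq_sym (negbTE (neq_lift _ _)) !mul0r addr0.
rewrite y'E /e eqxx mul1r.
have -> : a / w * w ^+ 2 = a * w by rewrite expr2 mulrA divfK ?gt_eqF.
lra.
Qed.

Lemma margin_robust_feasible m n (A : 'M[R]_(m.+1, n)) b x (a : R) :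
  0 <= a ->
  enorm (row' ord_max (A *m x + b)) <= - (A *m x + b) ord_max 0
    - a * (Num.sqrt m%:R + 1) * enorm (vpair x 1) ->
  robust_feasible_set (@second_order_cone R m) A b (const_mx a) x.
Proof.
move=> a0; set w := enorm (vpair x 1); set y := A *m x + b => yx A' b' unc.
apply/feasible_socP; set y' := A' *m x + b'.
have w0 : 0 < w := enorm_vpair1_gt0 x.
have dy i : `|(y' - y) i 0| <= a * w.
  have [u u1 uE] := unc i.
  have -> : (y' - y) i 0 = a * dot u (vpair x 1).
    rewrite mxE [(- y) i 0]mxE !data_dotE -uE dotDl dotZl mxE.
    by rewrite addrAC subrr add0r.
  rewrite normrM ger0_norm // ler_wpM2l // ler_norml.
  have bd v : enorm v <= 1 -> dot v (vpair x 1) <= w.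
    move=> v1; apply: le_trans (cauchy_schwarz _ _) _.
    by rewrite ler_piMl ?enorm_ge0.
  by rewrite bd // andbT lerNl -mulN1r -dotZl scaleN1r bd ?enormN.
(* The first [m] coordinates together cost [sqrt m * a * w], the last one [a * w] more. *)
have yh : enorm (row' ord_max (y' - y)) <= Num.sqrt m%:R * (a * w).
  by apply: enorm_le_coord => [i|]; rewrite ?mulr_ge0 ?(ltW w0) // mxE.
have := enormD (row' ord_max y) (row' ord_max (y' - y)).
rewrite -raddfD /= addrC subrK => h.
have := dy ord_max; rewrite mxE [(- y) _ _]mxE ler_norml => /andP[_ dm].
nra.
Qed.

End SecondOrderCone.

(** * Duality between margins and the second-order cone program *)

Section ConicDuality.
Variables (R : realType) (m n : nat).
Variables (A : 'M[R]_(m.+1, n)) (b : 'cV[R]_m.+1).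

(** Sends a multiplier [l] to the point [(z, s)] of the program with the smallest allowed [s]. *)
Let B : 'M[R]_(n + 1, m.+1) := col_mx A^T (- b^T).

Let B_mulE l : B *m l = vpair (A^T *m l) (- (b^T *m l) 0 0).
Proof.
rewrite mul_col_mx mulNmx /vpair; congr col_mx.
by rewrite raddfN /= -mx11_scalar.
Qed.

Lemma soc_base_convex (l1 l2 : 'cV[R]_m.+1) (t : R) :
  soc_base l1 -> soc_base l2 -> 0 <= t <= 1 -> soc_base (l1 + t *: (l2 - l1)).
Proof.
move=> [h1 e1] [h2 e2] /andP[t0 t1]; split; last by rewrite !mxE e1 e2; ring.
have -> : row' ord_max (l1 + t *: (l2 - l1)) =
    (1 - t) *: row' ord_max l1 + t *: row' ord_max l2.
  by apply/colP => i; rewrite !mxE; ring.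
apply: le_trans (enormD _ _) _; rewrite !enormZ !ger0_norm ?subr_ge0 //.
nra.
Qed.

Lemma soc_base_enorm (l : 'cV[R]_m.+1) : soc_base l -> enorm l <= 2.
Proof.
move=> [h e]; rewrite enorm_leP // (dot_row' ord_max) e -enorm_sqr.
by have := enorm_ge0 (row' ord_max l); nra.
Qed.

Lemma enorm_vpair0 (s : R) : enorm (vpair (0 : 'cV[R]_n) s) = `|s|.
Proof.
by rewrite enormE dot_vpair -(scale0r 0) dotZl mul0r add0r -expr2 sqrtr_sqr.
Qed.

(* For p = (z, s) in the feasible set with s > 0 and almost minimal norm, the
   point - z / s works; s > 0 is free since s is unbounded above. *)
Lemma socp_margin (F c : R) :
  (forall z s t l, socp_feasible A b z s t l -> F <= t) ->
  (forall e : R, 0 < e -> exists z s t l, socp_feasible A b z s t l /\ t < F + e) ->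
  0 <= c < F ->
  exists x, enorm (row' ord_max (A *m x + b)) <=
    - (A *m x + b) ord_max 0 - c * enorm (vpair x 1).
Proof.
move=> lbF infF /andP[c0 cF]; have F0 : 0 < F by lra.
pose S : set 'cV[R]_(n + 1) :=
  [set p | exists l (s : R), [/\ soc_base l, 0 <= s & p = B *m l + vpair 0 s]].
have convS p q (t : R) : S p -> S q -> 0 <= t <= 1 -> S (p + t *: (q - p)).
  move=> [l1 [s1 [l1P s10 ->]]] [l2 [s2 [l2P s20 ->]]] t01.
  exists (l1 + t *: (l2 - l1)), (s1 + t * (s2 - s1)); split.
  - exact: soc_base_convex.
  - by move/andP: t01 => [t0 t1]; nra.
  - rewrite !B_mulE /vpair !(opp_col_mx, add_col_mx, scale_col_mx).
    congr col_mx.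
      by rewrite !addr0 mulmxDr -scalemxAr mulmxBr.
    apply/colP => i; rewrite (ord1 i) mulmxDr -scalemxAr mulmxBr.
    rewrite !mxE eqxx !mulr1n; set u := \sum_j _; set v := \sum_j _; ring.
have SF p : S p -> F <= enorm p.
  move=> [l [s [[l1 lE] s0 ->]]]; rewrite B_mulE vpairD0.
  apply: (lbF _ (- (b^T *m l) 0 0 + s) _ l).
  by split; rewrite ?lerDl.
have [M M0 BM] := enorm_mul_bounded B.
(* With this tolerance and [|p| < F + (F - c) / 2], the bound [c * |p| <= F^2 - d] used below
   reduces to [0 <= (F - c)^2]. *)
have d0 : 0 < F * (F - c) / 2 by rewrite divr_gt0 // mulr_gt0 // subr_gt0.
have [e e0 proj] := approximate_projection (M * 2) convS SF (ltW F0) d0.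
pose e' : R := Num.min e ((F - c) / 2).
have e'0 : 0 < e' by rewrite lt_min e0 divr_gt0 // subr_gt0.
have e'20 : 0 < e' / 2 by rewrite divr_gt0.
have e'e : e' <= e by rewrite ge_min lexx.
have e'c : e' <= (F - c) / 2 by rewrite ge_min lexx orbT.
have [z [s [t [l [[zt zE sl l1 lE] tF]]]]] := infF _ e'20.
(* Replacing [s] by its absolute value keeps the norm, and adding [e' / 2] makes division by [s']
   possible; both only raise [s], so [p] stays in [S]. *)
pose s' := `|s| + e' / 2; pose p := vpair z s'.
have s'0 : 0 < s' by rewrite /s'; have := normr_ge0 s; lra.
have Sp : S p.
  exists l, (s' + (b^T *m l) 0 0); split => //.
    by rewrite /s'; have := ler_norm s; lra.
  by rewrite B_mulE vpairD0 -zE addrCA addNr addr0.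
have pF : enorm p < F + e'.
  have -> : p = vpair z `|s| + vpair 0 (e' / 2) by rewrite vpairD0.
  apply: le_lt_trans (enormD _ _) _; rewrite enorm_vpair0 (gtr0_norm e'20).
  suff -> : enorm (vpair z `|s|) = enorm (vpair z s) by lra.
  by rewrite !enormE !dot_vpair -!expr2 real_normK ?num_real.
(* Scaled by [s'], the margin condition at [k] reads [c * |p| <= dot p (B *m k)]. *)
exists (- s'^-1 *: z); apply/soc_marginP => k kP.
have := proj p Sp (lt_le_trans pF _) (B *m k) _ _.
rewrite lerD2l e'e => /(_ isT).
have SBk : S (B *m k).
  by exists k, 0; split => //; rewrite /vpair raddf0 col_mx0 addr0.
have Bk2 : enorm (B *m k) <= M * 2.
  by apply: le_trans (BM k) _; rewrite ler_wpM2l // soc_base_enorm.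
move=> /(_ SBk Bk2) pBk.
have cp : c * enorm p <= dot p (B *m k).
  apply: le_trans pBk; have := enorm_ge0 p; nra.
have -> : vpair (- s'^-1 *: z) 1 = s'^-1 *: vpair (- z) s'.
  rewrite /vpair scale_col_mx scalerN scaleNr; congr col_mx.
  by rewrite scale_scalar_mx mulVf ?gt_eqF.
have -> : enorm (s'^-1 *: vpair (- z) s') = s'^-1 * enorm p.
  rewrite enormZ ger0_norm ?invr_ge0 ?(ltW s'0) //; congr (_ * _).
  by rewrite !enormE !dot_vpair -scaleN1r dotZl dotZr !mulN1r opprK.
have -> : dot k (A *m (- s'^-1 *: z) + b) = - (s'^-1 * dot p (B *m k)).
  rewrite B_mulE dot_vpair -dotE dotDr -dot_tr_mul dotZr (dotC z) (dotC k b).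
  by rewrite mulrDr mulNr mulrN mulrN mulKf ?gt_eqF // opprD opprK.
by rewrite lerN2 mulrCA ler_pM2l ?invr_gt0.
Qed.

(** Weak duality: with [w = |(x, 1)|], the margin gives [a * w <= - z.x - b.l <= - z.x + s], and
    Cauchy-Schwarz bounds the right side by [t * w]. *)
Lemma robust_le_socp a x z s t l :
  0 <= a ->
  robust_feasible_set (@second_order_cone R m) A b (const_mx a) x ->
  socp_feasible A b z s t l -> a <= t.
Proof.
move=> a0 /(robust_feasible_margin a0) /soc_marginP h [zt zE sl l1 lE].
rewrite -(ler_pM2r (enorm_vpair1_gt0 x)).
have {h} := h l (conj l1 lE); rewrite dotDr -dot_tr_mul -zE => h.
have := cauchy_schwarz (- vpair z s) (vpair x (- 1)).
have -> : enorm (vpair x (- 1)) = enorm (vpair x 1).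
  by rewrite !enormE !dot_vpair mulrNN.
rewrite enormN -scaleN1r dotZl dot_vpair.
move: sl; rewrite -dotE (dotC b); have := enorm_vpair1_gt0 x; nra.
Qed.

Lemma socp_value_fin : exists2 F : R, socp_value A b = F%:E & 0 <= F.
Proof.
have ge0 : (0 <= socp_value A b)%E.
  apply: le_ereal_inf_tmp => _ [t [z [s [l [zt _ _ _ _]]]] <-].
  by rewrite lee_fin (le_trans _ zt) ?enorm_ge0.
have : (socp_value A b < +oo)%E.
  (* The last unit vector lies in the base, so the program is feasible. *)
  pose l : 'cV[R]_m.+1 := delta_mx ord_max 0.
  pose z := A^T *m l; pose s := - (b^T *m l) 0 0.
  apply: le_lt_trans (ltry (enorm (vpair z s))).
  apply: ge_ereal_inf; exists (enorm (vpair z s))%:E => //.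
  exists (enorm (vpair z s)) => //.
  exists z, s, l; split=> //; last by rewrite mxE !eqxx.
  have -> : row' ord_max l = 0.
    by apply/colP => i; rewrite !mxE eq_sym (negbTE (neq_lift _ _)).
  by rewrite -(scale0r 0) enormZ normr0 mul0r.
case: (socp_value A b) ge0 => [F| |] //= F0 _.
by exists F => //; rewrite -lee_fin.
Qed.

End ConicDuality.

(** * The two bounds on the radius of robust feasibility *)

Theorem corollary4p2 (R : realType) (m n : nat)
    (A : 'M[R]_(m.+1, n)) (b : 'cV[R]_m.+1)
    (nominal_feasible :
       [set x : 'cV[R]_n | feasible (@second_order_cone R m) A b x] !=set0) :
  ((1 / (Num.sqrt (m.+1%:R - 1) + 1))%:E * socp_value A b
     <= radius_robust_feasibility (@second_order_cone R m) A b
     <= socp_value A b)%E.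
Proof.
apply/andP; split; last first.
  apply: ge_ereal_sup => _ [a [a0 [_ [x xrob]]] <-].
  apply: le_ereal_inf_tmp => _ [t [z [s [l feas]]] <-].
  by rewrite lee_fin (robust_le_socp a0 xrob feas).
have [F FE F0] := socp_value_fin A b.
have lbF z s t l : socp_feasible A b z s t l -> F <= t.
  move=> feas; rewrite -lee_fin -FE; apply: ge_ereal_inf.
  by exists t%:E => //; exists t => //; exists z, s, l.
have infF (e : R) : 0 < e -> exists z s t l, socp_feasible A b z s t l /\ t < F + e.
  move=> e0; have : (socp_value A b < (F + e)%:E)%E by rewrite FE lte_fin ltrDl.
  move=> /ereal_inf_lt[_ [t [z [s [l feas]]] <-]]; rewrite lte_fin => tF.
  by exists z, s, t, l.
rewrite FE -natr1 addrK -EFinM div1r.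
set k := Num.sqrt m%:R + 1; have k0 : 0 < k by rewrite ltr_wpDl ?ltr01 ?sqrtr_ge0.
have margin_le (a : R) x : 0 <= a ->
    enorm (row' ord_max (A *m x + b)) <=
      - (A *m x + b) ord_max 0 - a * k * enorm (vpair x 1) ->
    (a%:E <= radius_robust_feasibility (@second_order_cone R m) A b)%E.
  move=> a0 /(margin_robust_feasible a0) xrob; apply: le_ereal_sup_tmp.
  exists a%:E => //; exists a => //; split=> //; split; last by exists x.
  by move=> i; rewrite mxE.
(* A nominal solution has margin 0, so the supremum is not over the empty set and cannot be
   [-oo]. *)
have : (0 <= radius_robust_feasibility (@second_order_cone R m) A b)%E.
  have [x /feasible_socP x0] := nominal_feasible.
  by apply: (margin_le _ x); rewrite ?mul0r ?subr0.
case rhoE: radius_robust_feasibility => [rho| |]; [| by move=> _; exact: leey | by []].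
rewrite !lee_fin => rho0; rewrite leNgt; apply/negP.
rewrite mulrC ltr_pdivlMr // => rhoF.
(* If [rho * k < F], the midpoint is an attainable margin, and dividing it by [k] gives an
   admissible radius above [rho]. *)
have c01 : 0 <= (rho * k + F) / 2 < F.
  have rk0 : 0 <= rho * k by rewrite mulr_ge0 ?(ltW k0).
  by apply/andP; split; lra.
have /andP[c0 _] := c01; have [x] := socp_margin lbF infF c01.
rewrite -[_ / 2](divfK (lt0r_neq0 k0)).
move=> /(margin_le _ x (divr_ge0 c0 (ltW k0))).
by rewrite rhoE lee_fin ler_pdivrMr //; lra.
Qed.
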